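(* Let $r,p,n$ be positive integers with $p\mid r$ and let $k<n$. Then $$\sum_{g\in C_k}q^{\operatorname{fmaj}(g^{-1})}=[p]_{q^{kr/p}}\,[r(k+1)]_q\cdots[r(n-1)]_q\,[rn/p]_q,$$ that is, the left-hand side equals $[p]_{q^{kr/p}}\Big(\prod_{j=k+1}^{n-1}[rj]_q\Big)[rn/p]_q$ (an empty product being $1$).
   Context: For a nonnegative integer $m$ and an expression $x$, $[m]_x=1+x+\cdots+x^{m-1}$. $\mathbb N$ includes $0$; $\mathcal P_n=\{(\lambda_1,\dots,\lambda_n)\in\mathbb N^n:\lambda_1\ge\cdots\ge\lambda_n\}$. The wreath product $G(r,n)=\mathbb Z_r\wr S_n$ is the group (under composition) of permutations $g$ of the set of $r$-colored integers $i^z$ ($i\in\{1,\dots,n\}$, $z\in\mathbb Z_r=\mathbb Z/r\mathbb Z$) such that $g(i^0)=j^z$ implies $g(i^{z'})=j^{z+z'}$; write $g=[\sigma_1^{z_1},\dots,\sigma_n^{z_n}]$ when $g(i^0)=\sigma_i^{z_i}$. For $p\mid r$ take the cyclic subgroup of $G(r,n)$ of order $p$ generated by $[1^{r/p},2^{r/p},\dots,n^{r/p}]$ (not to be confused with the set $C_k$ below), and let $G(r,p,n)^*$ be the quotient of $G(r,n)$ by this subgroup. An element of $G(r,p,n)^*$ is also written $g=[\sigma_1^{z_1},\dots,\sigma_n^{z_n}]$ via any representative; integers are identified with their residues mod $r$ when used as colors. For $g=[\sigma_1^{z_1},\dots,\sigma_n^{z_n}]\in G(r,p,n)^*$ define: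 $\operatorname{HDes}(g)=\{i\in\{1,\dots,n-1\}: z_i=z_{i+1},\ \sigma_i>\sigma_{i+1}\}$; $h_i(g)=|\{j\ge i: j\in\operatorname{HDes}(g)\}|$; $(k_1(g),\dots,k_n(g))$ is the entrywise smallest element of $\mathcal P_n$ such that $g=[\sigma_1^{k_1(g)},\dots,\sigma_n^{k_n(g)}]$ in $G(r,p,n)^*$; $\lambda_i(g)=r\,h_i(g)+k_i(g)$; and the flag-major index $\operatorname{fmaj}(g)=\sum_{i=1}^n\lambda_i(g)$. For $k<n$, $C_k$ is the set of $g\in G(r,p,n)^*$ admitting a representative of the form $[\sigma_1^0,\dots,\sigma_k^0,\sigma_{k+1}^{z_{k+1}},\dots,\sigma_n^{z_n}]$ with $\sigma_1<\cdots<\sigma_k$.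
   Formalization: The identity is proved for all k<n with k≥1, and for k=0 only when p=1; for k=0 and p>1 it is false, since at q=1 the left side is r^n n!/p while the right side is r^n n! (e.g. r=p=2, n=1). *)

(* Defs.v *)
From mathcomp Require Import all_boot all_order all_algebra all_fingroup cyclic center.
From mathcomp Require boolp classical_sets.

Set Implicit Arguments.
Unset Strict Implicit.
Unset Printing Implicit Defensive.

Import GRing.Theory.
Local Open Scope ring_scope.

Definition qint (R : nzRingType) (m : nat) (x : R) : R := \sum_(i < m) x ^+ i.

(* Z/rZ for r > 0.  'Z_r is not used because 'Z_1 denotes Z/2Z. *)
Notation color r := 'I_(r.-1.+1).

(* The residue of an integer mod r, for r > 0. *)
Definition tocolor (r m : nat) : color r := inZp m.

(* (i, z) is the colored integer i^z; integers are numbered from 0. *)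
Notation colored r n := ('I_n * color r)%type.

Section Wreath.
Variables r n : nat.

(* The permutation product of the library is s * t = t \o s, so this is the
   opposite of the group under composition; both have the same inverses, and
   the same cosets of the central subgroup shift_group below. *)
Definition wreath_set : {set {perm colored r n}} :=
  [set x : {perm colored r n} | [forall i, forall j, forall z, forall z',
     (x (i, 0) == (j, z)) ==> (x (i, z') == (j, z + z'))]].

Lemma wreathP (x : {perm colored r n}) :
  reflect (forall i j z z', x (i, 0) = (j, z) -> x (i, z') = (j, z + z'))
          (x \in wreath_set).
Proof.
rewrite inE; apply: (iffP forallP) => [H i j z z' /eqP e|H i].
  have /forallP/(_ j)/forallP/(_ z)/forallP/(_ z')/implyP := H i.
  by move=> /(_ e)/eqP.
by do 3 apply/forallP => ?; apply/implyP => /eqP /H ->.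
Qed.

Lemma wreath_group_set : group_set wreath_set.
Proof.
apply/group_setP; split=> [|x y /wreathP Hx /wreathP Hy].
  by apply/wreathP => i j z z'; rewrite !perm1 => -[-> <-]; rewrite add0r.
apply/wreathP => i j z z'; rewrite !permM.
case Ex : (x (i, 0)) => [i1 z1]; case Ey : (y (i1, 0)) => [j1 w1].
rewrite (Hx _ _ _ _ Ex) (Hy _ _ _ z1 Ey) (Hy _ _ _ (z1 + z') Ey) => -[-> <-].
by rewrite addrA.
Qed.

(* G(r,n) *)
Canonical wreath : {group {perm colored r n}} := Group wreath_group_set.

Lemma window_inj (s : 'S_n) (z : {ffun 'I_n -> color r}) :
  injective (fun a : colored r n => (s a.1, z a.1 + a.2)).
Proof.
move=> [i a] [j b] e.
have /perm_inj ij : s i = s j := congr1 fst e.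
have : z i + a = z j + b := congr1 snd e.
by rewrite ij => /addrI ->.
Qed.

(* [s_1^(z_1), ..., s_n^(z_n)] *)
Definition window (s : 'S_n) (z : {ffun 'I_n -> color r}) :
  {perm colored r n} := perm (@window_inj s z).

Lemma windowE s z i w : window s z (i, w) = (s i, z i + w).
Proof. by rewrite permE. Qed.

Lemma window_in s z : window s z \in wreath.
Proof.
by apply/wreathP => i j w w'; rewrite !windowE => -[-> <-]; rewrite addr0.
Qed.

Lemma wreath_window x : x \in wreath -> exists s z, x = window s z.
Proof.
move=> /wreathP Hx.
have HE i w : x (i, w) = ((x (i, 0)).1, (x (i, 0)).2 + w).
  by case E : (x (i, 0)) => [j z]; rewrite (Hx _ _ _ w E).
have sI : injective (fun i => (x (i, 0)).1).
  move=> i j /= e.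
  have : x (i, - (x (i, 0)).2) = x (j, - (x (j, 0)).2).
    by rewrite HE (HE j) !subrr e.
  by move/perm_inj => [].
exists (perm sI), [ffun i => (x (i, 0)).2]; apply/permP => -[i w].
by rewrite windowE permE ffunE HE.
Qed.

End Wreath.

Section ProjectiveReflectionGroup.
Variables r p n : nat.

(* The subgroup generated by [1^(r/p), ..., n^(r/p)] *)
Definition shift : {perm colored r n} :=
  window 1%g [ffun=> tocolor r (r %/ p)].

Definition shift_group : {group {perm colored r n}} := <[shift]>%G.

Lemma shiftX m i w :
  (shift ^+ m)%g (i, w) = (i, tocolor r (r %/ p) *+ m + w).
Proof.
elim: m w => [|m IH] w; first by rewrite expg0 perm1 mulr0n add0r.
by rewrite expgSr permM IH windowE perm1 ffunE mulrS addrA.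
Qed.

Lemma tocolorD a b : tocolor r (a + b) = tocolor r a + tocolor r b.
Proof. by apply: val_inj; rewrite /= modnDm. Qed.

Lemma tocolorB a b : (b <= a)%N ->
  tocolor r (a - b) = tocolor r a - tocolor r b.
Proof.
by move=> ba; apply/eqP; rewrite eq_sym subr_eq -tocolorD subnK.
Qed.

Lemma tocolorM a m : tocolor r (a * m) = tocolor r a *+ m.
Proof.
elim: m => [|m IH]; last by rewrite mulnS tocolorD IH mulrS.
by rewrite muln0; apply: val_inj; rewrite /= mod0n.
Qed.

Lemma tocolorK (z : color r) : tocolor r z = z.
Proof. exact: valZpK. Qed.

Lemma tocolor_eq0 a : (0 < r)%N -> (tocolor r a == 0) = (r %| a)%N.
Proof. by move=> r0; rewrite -val_eqE /= /dvdn prednK. Qed.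

Lemma order_shift :
  (0 < r)%N -> (0 < n)%N -> (p %| r)%N -> #[shift]%g = p.
Proof.
move=> r0 n0 pr.
have p0 : (0 < p)%N by apply: dvdn_gt0 pr.
have shE m : ((shift ^+ m)%g == 1%g) = (p %| m)%N.
  have -> : (p %| m)%N = (tocolor r (r %/ p) *+ m == 0).
    rewrite -tocolorM tocolor_eq0 //.
    have d0 : (0 < r %/ p)%N by rewrite divn_gt0 // dvdn_leq.
    by rewrite -(dvdn_pmul2l d0) divnK.
  apply/eqP/eqP => [e|e].
    have := shiftX m (Ordinal n0) 0.
    by rewrite e perm1 addr0 => -[->].
  by apply/permP => -[i w]; rewrite shiftX perm1 e add0r.
have dE m : (#[shift]%g %| m)%N = (p %| m)%N.
  by rewrite -shE -order_dvdn.
by apply/eqP; rewrite eqn_dvd dE dvdnn -dE dvdnn.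
Qed.

Lemma shift_central : (shift_group \subset 'Z(wreath r n))%g.
Proof.
rewrite cycle_subG; apply/centerP; split=> [|x]; first exact: window_in.
move=> /wreath_window[s [z ->]]; apply/permP => -[i w].
by rewrite !permM !windowE !perm1 !ffunE addrCA.
Qed.

Lemma shift_normal : (shift_group <| wreath r n)%g.
Proof. exact: sub_center_normal shift_central. Qed.

Lemma window_norm s z : window s z \in 'N(shift_group)%g.
Proof. exact: (subsetP (normal_norm shift_normal) _ (window_in s z)). Qed.

(* G(r,p,n)^* *)
Definition Gstar : {group coset_of shift_group} :=
  (wreath r n / shift_group)%G.

Implicit Type g : coset_of shift_group.

(* The permutation and the colors are read off the chosen representative of the
   coset; s_i does not depend on it (sigma_coset), and z_i does only up to a
   translation that is the same for all i (col_coset). *)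
Definition sigma g (i : 'I_n) : 'I_n := (repr g (i, 0)).1.
Definition col g (i : 'I_n) : color r := (repr g (i, 0)).2.

Lemma coset_shift s z g : g = coset shift_group (window s z) ->
  forall x, x \in (g : {set _}) ->
  exists t, forall i, x (i, 0) = (s i, tocolor r (r %/ p) *+ t + z i).
Proof.
move=> -> x.
rewrite val_coset ?window_norm // => /rcosetP[y /cycleP[t ->] ->]; exists t => i.
by rewrite permM shiftX windowE addr0 addrC.
Qed.

Lemma sigma_coset s z i : sigma (coset shift_group (window s z)) i = s i.
Proof.
have [t tE] := coset_shift (erefl (coset shift_group (window s z)))
                           (mem_repr_coset _).
by rewrite /sigma tE.
Qed.

Lemma col_coset s z : exists t, forall i,
  col (coset shift_group (window s z)) i = tocolor r (r %/ p) *+ t + z i.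
Proof.
have [t tE] := coset_shift (erefl (coset shift_group (window s z)))
                           (mem_repr_coset _).
by exists t => i; rewrite /col tE.
Qed.

Definition HDes g : {set 'I_n} :=
  [set i : 'I_n | [exists j : 'I_n,
     [&& val j == i.+1, col g i == col g j & (sigma g j < sigma g i)%N]]].

Definition hstat g (i : 'I_n) : nat := #|[set j in HDes g | (i <= j)%N]|.

(* P_n *)
Definition is_partition (a : {ffun 'I_n -> nat}) : Prop :=
  forall i j : 'I_n, (i <= j)%N -> (a j <= a i)%N.

(* g = [s_1^(a_1), ..., s_n^(a_n)] in G(r,p,n)^*, where s_i = sigma g i *)
Definition has_colors g (a : {ffun 'I_n -> nat}) : Prop :=
  exists2 s : 'S_n, (forall i, s i = sigma g i) &
    g = coset shift_group (window s [ffun i => tocolor r (a i)]).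

Definition is_kmin g (a : {ffun 'I_n -> nat}) : Prop :=
  [/\ is_partition a, has_colors g a &
      forall b, is_partition b -> has_colors g b -> forall i, (a i <= b i)%N].

(* (k_1(g), ..., k_n(g)); the default value of xget is irrelevant for
   g in G(r,p,n)^*, by kvec_spec below. *)
Definition kvec g : {ffun 'I_n -> nat} :=
  classical_sets.xget [ffun=> 0%N] (is_kmin g).

Lemma coset_window (s : 'S_n) (z : {ffun 'I_n -> color r}) t :
  coset shift_group (window s [ffun i => tocolor r (r %/ p) *+ t + z i]) =
  coset shift_group (window s z).
Proof.
apply/(rcoset_kercosetP (window_norm _ _) (window_norm _ _))/rcosetP; exists (shift ^+ t)%g.
  exact: mem_cycle.
apply/permP => -[i w]; rewrite permM shiftX !windowE ffunE.
by rewrite [tocolor _ _ *+ _ + w]addrC [w + _]addrC addrCA addrA.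
Qed.

Lemma has_colorsP (s : 'S_n) (z : {ffun 'I_n -> color r}) a :
  has_colors (coset shift_group (window s z)) a <->
  exists t, forall i, tocolor r (a i) = tocolor r (r %/ p) *+ t + z i.
Proof.
split=> [[s' sE gE]|[t tE]]; last first.
  exists s => [i|]; first by rewrite sigma_coset.
  rewrite -(coset_window s z t); congr (coset _ (window _ _)).
  by apply/ffunP => i; rewrite !ffunE tE.
have xin : window s' [ffun i => tocolor r (a i)] \in
    (coset shift_group (window s z) : {set _}).
  by rewrite gE val_coset ?window_norm // rcoset_refl.
have [t tE] := coset_shift (erefl _) xin.
exists t => i; have := tE i; rewrite windowE ffunE addr0 => e.
exact: (congr1 snd e).
Qed.

Lemma kmin_exists g : (0 < r)%N -> (0 < n)%N -> (p %| r)%N -> g \in Gstar ->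
  exists a, is_kmin g a.
Proof.
move=> r0 n0 pr gG.
have [s [z gE]] : exists s z, g = coset shift_group (window s z).
  have /morphimP[x xN xG ->] := gG.
  by have [s [z ->]] := wreath_window xG; exists s, z.
pose adm a := is_partition a /\ has_colors g a.
pose d := (r %/ p)%N.
have d0 : (0 < d)%N by rewrite divn_gt0 ?(dvdn_gt0 r0 pr) // dvdn_leq.
pose l : 'I_n := Ordinal (etrans (congr1 (leq^~ n) (prednK n0)) (leqnn n)).
have lP (i : 'I_n) : (i <= l)%N by rewrite /= -ltnS prednK.
have ex : exists a, adm a.
  exists [ffun i : 'I_n => (z i + r * (n - i))%N]; split.
    move=> i j; rewrite !ffunE leq_eqVlt => /orP[/eqP/val_inj ->//|ij].
    apply: (@leq_trans (r * (n - i))%N); last exact: leq_addl.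
    have -> : (n - i = (n - i).-1.+1)%N by rewrite prednK // subn_gt0.
    rewrite mulnS leq_add //; first by rewrite -[X in (_ <= X)%N](prednK r0) ltnW.
    by rewrite leq_mul2l -subnS leq_sub2l ?orbT.
  rewrite gE; apply/has_colorsP; exists 0%N => i.
  rewrite ffunE mulr0n add0r tocolorD tocolorK tocolorM.
  have /eqP -> : tocolor r r == 0 by rewrite tocolor_eq0.
  by rewrite mul0rn addr0.
have low a b : adm a -> adm b -> (a l <= b l)%N ->
    exists2 c, adm c & forall i, (c i <= a i)%N /\ (c i <= b i)%N.
  move=> [pa ca] [pb cb] ab.
  move: ca cb; rewrite gE => /has_colorsP[ta taE] /has_colorsP[tb tbE].
  have /dvdnP[m mE] : (d %| b l - a l)%N.
    have [u uE] : exists u, tocolor r (b l - a l + d * u) = 0.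
      exists (ta + (p * tb - tb))%N.
      rewrite tocolorD tocolorB // taE tbE tocolorM mulrnDr -/d.
      rewrite mulrnBr ?leq_pmull ?(dvdn_gt0 r0 pr) // mulrnA -(tocolorM d p).
      rewrite [(d * p)%N]divnK //.
      have /eqP -> : tocolor r r == 0 by rewrite tocolor_eq0.
      rewrite mul0rn sub0r opprD [X in X + _]addrACA subrr addr0.
      by rewrite addrA subrK subrr.
    move/eqP: uE; rewrite tocolor_eq0 // => ru.
    have : (d %| b l - a l + d * u)%N.
      by apply: dvdn_trans ru; apply: dvdn_div.
    by rewrite dvdn_addl // dvdn_mulr.
  have mb i : (m * d <= b i)%N.
    by rewrite -mE (leq_trans (leq_subr _ _)) // pb.
  have sE : tocolor r d *+ tb - tocolor r (m * d) = tocolor r d *+ ta.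
    have := tbE l; rewrite -[in LHS](subnK ab) mE tocolorD taE => e.
    apply/eqP; rewrite subr_eq [_ + tocolor r (m * d)]addrC.
    by apply/eqP; apply: (@addIr _ (z l)); rewrite -e addrA.
  exists [ffun i => minn (a i) (b i - m * d)].
    split.
      move=> i j ij; rewrite !ffunE leq_min !geq_min pa //=.
      by rewrite (leq_sub2r _ (pb _ _ ij)) orbT.
    rewrite gE; apply/has_colorsP; exists ta => i; rewrite ffunE /minn.
    case: ifP => _; first exact: taE.
    by rewrite tocolorB // tbE -sE addrAC.
  by move=> i; rewrite ffunE geq_minl geq_min leq_subr orbT.
pose sz (a : {ffun 'I_n -> nat}) := (\sum_i a i)%N.
have [m [[a aA am] mmin]] : exists m, (exists2 a, adm a & sz a = m) /\
    forall b, adm b -> (m <= sz b)%N.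
  have exm : exists m, boolp.asbool (exists2 a, adm a & sz a = m).
    by have [a aA] := ex; exists (sz a); apply/boolp.asboolP; exists a.
  case: (ex_minnP exm) => m /boolp.asboolP mP mmin; exists m; split=> // b bA.
  by apply: mmin; apply/boolp.asboolP; exists b.
exists a; case: (aA) => pa ca; split=> // b pb cb i.
have [c cA cE] : exists2 c, adm c & forall i, (c i <= a i)%N /\ (c i <= b i)%N.
  have [ab|ba] := leqP (a l) (b l); first exact: low.
  have [] := low b a (conj pb cb) aA (ltnW ba).
  by move=> c cA cE; exists c => // j; have [] := cE j.
have eqs : sz c == sz a.
  by rewrite eqn_leq [in X in _ && X]am mmin // andbT leq_sum // => j _; case: (cE j).
have leif : forall j, true -> (c j <= a j ?= iff (c j == a j))%N.
  by move=> j _; split=> //; case: (cE j).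
have /forallP/(_ i) : [forall (j | true), c j == a j].
  by rewrite -(leqif_sum leif).
by move=> /eqP <-; case: (cE i).
Qed.

Lemma kvec_spec g : (0 < r)%N -> (0 < n)%N -> (p %| r)%N -> g \in Gstar ->
  is_kmin g (kvec g).
Proof.
by move=> r0 n0 pr gG; have [a aP] := kmin_exists r0 n0 pr gG; apply: (classical_sets.xgetI _ aP).
Qed.

Definition lambda g (i : 'I_n) : nat := (r * hstat g i + kvec g i)%N.

Definition fmaj g : nat := (\sum_(i < n) lambda g i)%N.

(* C_k *)
Definition Cset (k : nat) : {set coset_of shift_group} :=
  [set g in Gstar | [exists s : 'S_n, exists z : {ffun 'I_n -> color r},
     [&& g == coset shift_group (window s z),
         [forall i : 'I_n, (i < k)%N ==> (z i == 0)] &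
         [forall i : 'I_n, forall j : 'I_n,
            (i < j < k)%N ==> (s i < s j)%N]]]].

End ProjectiveReflectionGroup.

(* Main.v *)
Require Import Defs.
From mathcomp Require Import all_boot all_order all_algebra all_fingroup.
From mathcomp Require Import zify ring.

(** The idea is to count vectors [a] in N^n in two ways.

    Sorting the entries of [a] decreasingly, with ties broken by the index, and
    reading the sorted entries mod [r] as colors gives an element of the
    quotient group; let [standardize a] be its inverse.  For a given [g] in the
    group, the vectors [a] with [standardize a = g] are exactly those whose
    sorted form is [lambda (g^-1) + mu], where [mu] is any partition whose parts
    are congruent mod [r] and divisible by [d = r/p]
    ([compatible_lambda], [lambda_compatible]).  Here the minimality of
    [kvec] makes [lambda (g^-1)] the least sorted vector of its fibre, and the
    term [r * hstat] is the price of a descent between two letters of the same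
    color: such letters cannot be tied, so their entries differ by at least [r].
    Such partitions [mu] are freely generated by columns of height [j] repeated
    [r] times ([j < n]) and columns of height [n] repeated [d] times ([stair]).

    Moreover [standardize a] lies in C_k if and only if the first [k] entries
    of [a] are weakly decreasing, congruent mod [r] and divisible by [d]
    ([standardize_Cset]): the letters [1..k] occur in increasing order in
    [g^-1] and carry one common color, up to a multiple of [d].  The set of
    these vectors is itself freely generated, by the same staircase construction
    applied to the first [k] entries and by unit vectors for the others.

    Hence, writing [w_j] and [w'_j] for the sizes of the two families of
    generators, the sum over C_k divided by [prod_j (1 - q^(w_j))] and
    [1 / prod_j (1 - q^(w'_j))] are the same generating function
    ([prod_fmaj]).  As [(1 - q) [m]_q = 1 - q^m], comparing the two products gives
    the formula.  The identity between power series is proved between their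
    truncations at every order, which only involve polynomials. *)

Set Implicit Arguments.
Unset Strict Implicit.
Unset Printing Implicit Defensive.

Import GRing.Theory.
Local Open Scope ring_scope.

(** * Generating functions of freely generated sets of vectors *)

(** Congruence modulo ['X^N]. *)
Definition eq_upto (N : nat) (P Q : {poly int}) : Prop :=
  forall i, (i < N)%N -> P`_i = Q`_i.

Lemma eq_upto_trans N P Q S : eq_upto N P Q -> eq_upto N Q S -> eq_upto N P S.
Proof. by move=> PQ QS i iN; rewrite PQ ?QS. Qed.

Lemma eq_upto_sym N P Q : eq_upto N P Q -> eq_upto N Q P.
Proof. by move=> PQ i iN; rewrite PQ. Qed.

Lemma eq_uptoM N P P' Q Q' :
  eq_upto N P P' -> eq_upto N Q Q' -> eq_upto N (P * Q) (P' * Q').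
Proof.
move=> PP QQ i iN; rewrite !coefM; apply: eq_bigr => j _.
by rewrite PP ?QQ //; move: (ltn_ord j); lia.
Qed.

Lemma eq_upto_all P Q : (forall N, eq_upto N P Q) -> P = Q.
Proof. by move=> PQ; apply/polyP => i; apply: PQ (leqnn _). Qed.

Lemma eq_upto_sum (N : nat) (T : finType) (D : pred T) (f : T -> nat) :
  eq_upto N (\sum_(x | D x) 'X^(f x)) (\sum_(x | D x && (f x < N)%N) 'X^(f x)).
Proof.
move=> i iN; rewrite !coef_sum big_mkcondr; apply: eq_bigr => x _.
by rewrite coefXn; case: ltnP => // Nf; rewrite (_ : (i == f x) = false) //; lia.
Qed.

Lemma qintM (m : nat) (x : {poly int}) : qint m x * (1 - x) = 1 - x ^+ m.
Proof. by rewrite -[X in _ = X]opprB subrX1 mulrC -mulNr opprB. Qed.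

Definition nvec (n N : nat) (m : {ffun 'I_n -> 'I_N}) : {ffun 'I_n -> nat} :=
  [ffun i => m i : nat].

Lemma nvec_inj n N : injective (@nvec n N).
Proof.
move=> m m' /ffunP e; apply/ffunP => i; apply: val_inj.
by have := e i; rewrite !ffunE.
Qed.

Section GeneratingFunction.
Variables (n : nat) (T : finType) (H : {set T}) (f : T -> nat).
Variables (w : 'I_n -> nat) (phi : T -> {ffun 'I_n -> nat} -> {ffun 'I_n -> nat}).
Variable (A : pred {ffun 'I_n -> nat}).
Hypothesis w_gt0 : forall j, (0 < w j)%N.
Hypothesis phi_weight : forall h m, h \in H ->
  (\sum_i phi h m i = f h + \sum_j w j * m j)%N.
Hypothesis phi_inj : forall h h' m m', h \in H -> h' \in H ->
  phi h m = phi h' m' -> h = h' /\ m = m'.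
Hypothesis phi_image : forall a,
  A a <-> exists2 h, h \in H & exists m, a = phi h m.

(** A weight-preserving bijection [phi] from [H] x N^n to the vectors satisfying
    [A] says, between power series, that the sum of ['X^f] over [H] times
    [prod_j 1 / (1 - 'X^(w j))] enumerates [A] by size.  Since all [w j] are
    positive, only vectors with entries at most [N] matter modulo ['X^N.+1], on
    both sides, so [phi] restricts to a bijection between finite sets. *)
Lemma gf_image N :
  eq_upto N.+1 (\sum_(h in H) 'X^(f h))
    ((\prod_j (1 - 'X^(w j))) *
     \sum_(a : {ffun 'I_n -> 'I_N.+1} | A (nvec a)) 'X^(\sum_i a i)).
Proof.
pose q (x : T * {ffun 'I_n -> 'I_N.+1}) := (f x.1 + \sum_j w j * x.2 j)%N.
have sumE : \sum_(x | x.1 \in H) 'X^(q x) =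
    (\sum_(h in H) 'X^(f h)) * \prod_j qint N.+1 ('X^(w j)) :> {poly int}.
  rewrite /qint bigA_distr_bigA mulr_suml.
  rewrite [RHS](eq_bigr (fun h => \sum_m 'X^(q (h, m)))) => [|h _].
    rewrite pair_big; apply: eq_big => [x|[]//]; exact/esym/andbT.
  rewrite mulr_sumr; apply: eq_bigr => m _.
  rewrite /q exprD; congr (_ * _); rewrite /= -prodrXr.
  by apply: eq_bigr => j _; rewrite exprM.
(* the truncated geometric series inverts 1 - 'X^(w j) *)
have cancel : eq_upto N.+1
    ((\prod_j (1 - 'X^(w j))) * \sum_(x | x.1 \in H) 'X^(q x))
    (\sum_(h in H) 'X^(f h)).
  rewrite sumE mulrCA -big_split /= -[X in eq_upto _ _ X]mulr1.
  apply: eq_uptoM => //.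
  elim: (index_enum _) => [|j s IH]; first by rewrite big_nil.
  rewrite big_cons -[X in eq_upto _ _ X]mul1r; apply: eq_uptoM IH => i iN.
  rewrite mulrC qintM coefB -exprM coefXn (_ : (i == _) = false) ?subr0 //.
  by have := w_gt0 j; nia.
pose F (x : T * {ffun 'I_n -> 'I_N.+1}) : {ffun 'I_n -> 'I_N.+1} :=
  [ffun i => inord (phi x.1 (nvec x.2) i)].
have qE x : x.1 \in H -> (q x = \sum_i phi x.1 (nvec x.2) i)%N.
  by move=> xH; rewrite phi_weight //; congr addn; apply: eq_bigr => j _; rewrite ffunE.
have FE x : x.1 \in H -> (q x < N.+1)%N -> nvec (F x) = phi x.1 (nvec x.2).
  move=> xH; rewrite qE // => qN; apply/ffunP => i; rewrite !ffunE inordK //.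
  by apply: leq_ltn_trans qN; rewrite (bigD1 i) //= leq_addr.
pose D := [set x | (x.1 \in H) && (q x < N.+1)%N].
have FI : {in D &, injective F}.
  move=> [h m] [h' m']; rewrite !inE => /andP[xH xq] /andP[yH yq] e.
  by have := FE _ xH xq; rewrite e FE //= => /(phi_inj yH xH) /= [-> /nvec_inj ->].
suff main : eq_upto N.+1 (\sum_(x | x.1 \in H) 'X^(q x))
    (\sum_(a : {ffun 'I_n -> 'I_N.+1} | A (nvec a)) 'X^(\sum_i a i)).
  by move=> i iN; rewrite -cancel //; apply: eq_uptoM main i iN.
apply: eq_upto_trans (eq_upto_sum _ _) _.
suff -> : \sum_(x | (x.1 \in H) && (q x < N.+1)%N) 'X^(q x) =
  \sum_(a : {ffun 'I_n -> 'I_N.+1} | A (nvec a) && (\sum_i a i < N.+1)%N)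
    'X^(\sum_i a i) :> {poly int}.
  exact/eq_upto_sym/eq_upto_sum.
rewrite (eq_bigl (fun x => x \in D)) => [|x]; last by rewrite inE.
have wF x : x \in D -> (\sum_i F x i = q x)%N.
  rewrite inE => /andP[xH xq]; rewrite qE // -FE //.
  by apply: eq_bigr => i _; rewrite [RHS]ffunE.
transitivity (\sum_(a in F @: D) 'X^(\sum_i a i) : {poly int}).
  by rewrite big_imset //=; apply: eq_bigr => x /wF ->.
apply: eq_bigl => a; apply/imsetP/andP => [[x xD ->]|[aA aN]].
  rewrite wF //; move: xD; rewrite inE => /andP[xH xq]; split=> //.
  by rewrite FE //; apply/phi_image; exists x.1 => //; exists (nvec x.2).
have [h hH [m am]] := (phi_image _).1 aA.
have aE : (\sum_i a i = f h + \sum_j w j * m j)%N.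
  by rewrite -phi_weight // -am; apply: eq_bigr => i _; rewrite ffunE.
have mN j : (m j < N.+1)%N.
  apply: leq_ltn_trans aN; rewrite aE (bigD1 j) //=.
  by have := w_gt0 j; nia.
have mE : nvec [ffun j => inord (m j) : 'I_N.+1] = m.
  by apply/ffunP => j; rewrite !ffunE inordK.
have xD : (h, [ffun j => inord (m j)]) \in D.
  by rewrite inE /= hH qE //= mE phi_weight // -aE.
exists (h, [ffun j => inord (m j)]) => //.
apply: nvec_inj; rewrite FE /= ?mE //; first by move: xD; rewrite inE => /andP[].
Qed.

End GeneratingFunction.

(** * Staircase vectors *)

Section Staircase.
Variables (r d n k : nat).

(** The multiplicities in which the generators are taken: the column of height
    [j.+1] comes in multiples of [r], except the full column of height [k], which
    comes in multiples of [d]; an entry of index at least [k] is free. *)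
Definition gap (j : nat) : nat :=
  if (j.+1 < k)%N then r else if j.+1 == k then d else 1%N.

(** The combination of the generators with multiplicities [m]: on the first [k]
    entries, the partition with [gap j * m j] columns of height [j.+1]. *)
Definition stair (m : {ffun 'I_n -> nat}) : {ffun 'I_n -> nat} :=
  [ffun i : 'I_n => \sum_(j : 'I_n | (i == j :> nat) || (i <= j < k)%N) gap j * m j]%N.

(** The vectors freely generated by the staircases ([stair_tower],
    [tower_stair], [stair_inj]), described by inequalities and congruences. *)
Definition tower (a : {ffun 'I_n -> nat}) : bool :=
  [forall i : 'I_n, forall j : 'I_n, (i <= j < k)%N ==>
     [&& (a j <= a i)%N, a i == a j %[mod r] & (d %| a j)%N]].

Lemma towerP (a : {ffun 'I_n -> nat}) :
  reflect (forall i j : 'I_n, (i <= j < k)%N ->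
             [/\ (a j <= a i)%N, a i = a j %[mod r] & (d %| a j)%N])
          (tower a).
Proof.
apply: (iffP forallP) => [H i j ij|H i].
  by have /forallP/(_ j)/implyP/(_ ij)/and3P[? /eqP ? ?] := H i.
by apply/forallP => j; apply/implyP => /H[? ? ?]; apply/and3P; split=> //; apply/eqP.
Qed.

(** The sum of the entries of the generator of index [j]. *)
Definition stair_weight (j : nat) : nat := ((if (j < k)%N then j.+1 else 1) * gap j)%N.

Lemma sum_stair m : (\sum_i stair m i = \sum_(j < n) stair_weight j * m j)%N.
Proof.
under eq_bigr do rewrite ffunE.
rewrite (exchange_big_dep xpredT) //=; apply: eq_bigr => j _.
rewrite sum_nat_const /stair_weight -!mulnA; congr (_ * _)%N.
case: ltnP => jk.
  rewrite -sum1_card (eq_bigl (fun i : 'I_n => i < j.+1)%N) => [|i].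
    by rewrite -(big_ord_widen _ (fun=> 1%N)) // sum1_card card_ord.
  by rewrite unfold_in /=; lia.
rewrite -(card1 j); apply: eq_card => i; rewrite !inE -val_eqE /=; lia.
Qed.

(** Between two of the first [k] indices only columns other than the full one
    end, hence the congruence mod [r] of the first [k] entries. *)
Lemma stair_split m (i j : 'I_n) : (i <= j < k)%N ->
  (stair m i = stair m j + \sum_(l < n | i <= l < j) r * m l)%N.
Proof.
move=> ijk; rewrite !ffunE (bigID (fun l : 'I_n => (j <= l)%N)) /=; congr addn.
  by apply: eq_bigl => l; lia.
rewrite (eq_bigl (fun l : 'I_n => i <= l < j)%N) => [|l]; last by lia.
by apply: eq_bigr => l lij; rewrite /gap (_ : (l.+1 < k)%N = true) //; lia.
Qed.

Lemma stair_step m (i j : 'I_n) : val j = i.+1 -> (j < k)%N ->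
  (stair m i = r * m i + stair m j)%N.
Proof.
move=> ji jk; rewrite (@stair_split m i j) ?ji ?leqnSn -?ji //.
by rewrite addnC (big_pred1 i) // => l; rewrite /= -val_eqE /=; move: ji => /=; lia.
Qed.

Lemma stair_last m (i : 'I_n) : (k <= i.+1)%N -> (stair m i = gap i * m i)%N.
Proof.
by move=> ki; rewrite ffunE (big_pred1 i) // => l; rewrite /= -val_eqE /=; lia.
Qed.

Lemma stair_tower m : (d %| r)%N -> tower (stair m).
Proof.
move=> dr; apply/towerP => i j ijk; rewrite (stair_split _ ijk); split.
- exact: leq_addr.
- by rewrite -big_distrr /= addnC mulnC modnMDl.
- rewrite ffunE; apply: dvdn_sum => l jl; apply: dvdn_mulr.
  rewrite /gap; case: ifP => // lk; rewrite (_ : l.+1 == k) //; lia.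
Qed.

Lemma ord_down_ind (P : 'I_n -> Prop) :
  (forall i : 'I_n, (k <= i.+1)%N -> P i) ->
  (forall i j : 'I_n, val j = i.+1 -> (j < k)%N -> P j -> P i) ->
  (k <= n)%N -> forall i, P i.
Proof.
move=> Plast Pstep kn i; move eqm: (n - i)%N => m.
elim: m i eqm => [|m IH] i im; first by move: (ltn_ord i); lia.
have [ki|ik] := leqP k i.+1; first exact: Plast.
have jn : (i.+1 < n)%N by lia.
by apply: (Pstep i (Ordinal jn)) => //; apply: IH => /=; lia.
Qed.

(** The multiplicities are recovered from the successive differences. *)
Lemma tower_stair (a : {ffun 'I_n -> nat}) : (k <= n)%N -> tower a -> exists m, a = stair m.
Proof.
move=> kn /towerP aT.
pose next (i : 'I_n) := if insub i.+1 is Some j then a j else 0%N.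
exists [ffun i : 'I_n => if (i.+1 < k)%N then (a i - next i) %/ r else a i %/ gap i]%N.
set m := [ffun _ => _].
apply/ffunP; apply: ord_down_ind => // [i ki|i j ji jk aj].
  rewrite stair_last // ffunE ltnNge ki /= mulnC divnK //.
  rewrite /gap ltnNge ki /=; case: eqP => // ik.
  by have [|//] := aT i i; rewrite leqnn -ik ltnSn.
rewrite (stair_step _ ji jk) -aj ffunE -ji jk /next -ji valK.
have [|leji modij _] := aT i j; first by rewrite ji leqnSn -ji jk.
by rewrite mulnC divnK ?subnK // -eqn_mod_dvd // modij.
Qed.

Hypotheses (r_gt0 : (0 < r)%N) (d_gt0 : (0 < d)%N).
Hypothesis kn : (k <= n)%N.

Lemma gap_gt0 j : (0 < gap j)%N.
Proof. by rewrite /gap; case: ifP => // _; case: ifP. Qed.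

Lemma stair_weight_gt0 j : (0 < stair_weight j)%N.
Proof. by rewrite muln_gt0 gap_gt0; case: ifP. Qed.

Lemma stair_inj : injective stair.
Proof.
move=> m m' e; apply/ffunP; apply: ord_down_ind => // [i ki|i j ji jk _].
  have := congr1 (fun f : {ffun 'I_n -> nat} => f i) e.
  rewrite !stair_last // => /eqP; rewrite eqn_pmul2l ?gap_gt0 // => /eqP //.
have := congr1 (fun f : {ffun 'I_n -> nat} => f i) e.
rewrite !(stair_step _ ji jk) e => /eqP.
by rewrite eqn_add2r eqn_pmul2l // => /eqP.
Qed.

End Staircase.

(** * Sorting a vector *)

Lemma ord_chain n (R : rel 'I_n) : transitive R ->
  (forall i j : 'I_n, val j = i.+1 -> R i j) ->
  forall i j : 'I_n, (i < j)%N -> R i j.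
Proof.
move=> Rtr Rstep i j; move em: (j - i.+1)%N => m.
elim: m j em => [|m IH] j em ij; first by apply: Rstep => /=; lia.
have jn : (j.-1 < n)%N by move: (ltn_ord j); lia.
apply: (Rtr (Ordinal jn)); first by apply: IH => /=; lia.
by apply: Rstep => /=; lia.
Qed.

Section Ranking.
Variable n : nat.
Implicit Type a : {ffun 'I_n -> nat}.

(** The strict total order of the indices that sorts [a] decreasingly, ties being
    broken by the index. *)
Definition before a (i j : 'I_n) : bool :=
  (a j < a i)%N || ((a i == a j) && (i < j)%N).

Lemma before_trans a : transitive (before a).
Proof. by move=> j i l; rewrite /before; lia. Qed.

Lemma before_total a (i j : 'I_n) : i != j -> before a i j || before a j i.
Proof. by rewrite -val_eqE /before /=; lia. Qed.

Lemma before_asym a (i j : 'I_n) : before a i j -> ~~ before a j i.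
Proof. by rewrite /before; lia. Qed.

Definition rank_nat a (i : 'I_n) : nat := #|[set j | before a j i]|.

Lemma rank_nat_lt a i : (rank_nat a i < n)%N.
Proof.
rewrite -[X in (_ < X)%N](card_ord n) -cardsT; apply/proper_card/properP.
split; first exact: subsetT.
by exists i; rewrite ?inE // /before; lia.
Qed.

Lemma rank_nat_mono a i j : before a i j -> (rank_nat a i < rank_nat a j)%N.
Proof.
move=> ij; apply/proper_card/properP; split.
  by apply/subsetP => l; rewrite !inE => li; apply: before_trans li ij.
by exists i; rewrite ?inE // /before; lia.
Qed.

Lemma rank_inj a : injective (fun i => Ordinal (rank_nat_lt a i)).
Proof.
move=> i j [e]; apply/eqP/negPn/negP => /(before_total a)/orP[] /rank_nat_mono;
by rewrite e ltnn.
Qed.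

Definition rank a : 'S_n := perm (@rank_inj a).

Lemma rank_mono a i j : before a i j -> (rank a i < rank a j)%N.
Proof. by rewrite !permE; apply: rank_nat_mono. Qed.

Lemma rank_ltE a i j : (rank a i < rank a j)%N = before a i j.
Proof.
have [->|ij] := eqVneq i j; first by rewrite ltnn /before; lia.
have [/rank_mono ->//|nij] := boolP (before a i j).
by have := before_total a ij; rewrite (negPf nij) => /rank_mono; lia.
Qed.

Lemma rank_unique a (s : 'S_n) :
  (forall i j : 'I_n, (i < j)%N -> before a (s^-1 i)%g (s^-1 j)%g) -> rank a = s.
Proof.
move=> sB; apply/permP => i; apply: val_inj.
have ltE j : before a j i = (s j < s i)%N.
  have [lt|gt|/val_inj/perm_inj ->] := ltngtP (s j) (s i).
  - by have := sB _ _ lt; rewrite !permK => ->.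
  - by apply/negbTE/before_asym; have := sB _ _ gt; rewrite !permK.
  - by rewrite /before; lia.
rewrite permE /= /rank_nat -[RHS]card_ord.
rewrite -(card_imset _ (@perm_inj _ s)) -[RHS]sum1_card.
rewrite (big_ord_widen n (fun=> 1%N)) ?(ltnW (ltn_ord _)) // sum1_card.
apply: eq_card => x; rewrite [RHS]unfold_in; apply/imsetP/idP => [[j]|xi].
  by rewrite inE ltE => ? ->.
by exists (s^-1 x)%g; rewrite ?inE ?ltE permKV.
Qed.

End Ranking.

(** * The sorted vectors compatible with an element of the group *)

Section Colors.
Variables (r p n : nat).
Hypotheses (r_gt0 : (0 < r)%N) (n_gt0 : (0 < n)%N) (pr : (p %| r)%N).
Local Notation d := (r %/ p)%N.
Local Notation shifts := (shift_group r p n).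
Local Notation Gs := (Gstar r p n).
Local Notation cs := (coset shifts).

Lemma p_gt0 : (0 < p)%N. Proof. exact: dvdn_gt0 pr. Qed.
Lemma d_gt0 : (0 < d)%N. Proof. by rewrite divn_gt0 ?p_gt0 // dvdn_leq. Qed.
Lemma d_dvd_r : (d %| r)%N. Proof. exact: dvdn_div. Qed.

Lemma tocolor_eq a b : (tocolor r a == tocolor r b) = (a == b %[mod r]).
Proof. by rewrite -val_eqE /= prednK. Qed.

Lemma tocolor_dvd t x t' :
  tocolor r x = tocolor r d *+ t - tocolor r d *+ t' -> (d %| x)%N.
Proof.
move/eqP; rewrite eq_sym subr_eq -!tocolorM -tocolorD tocolor_eq => /eqP.
move/(congr1 (modn^~ d)); rewrite !modn_dvdm ?d_dvd_r // => /eqP.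
by rewrite modnMr eq_sym -/(dvdn _ _) dvdn_addl // dvdn_mulr.
Qed.

Lemma Gstar_window g : g \in Gs -> exists s z, g = cs (window s z).
Proof.
by case/morphimP => x _ xG ->; have [s [z ->]] := wreath_window xG; exists s, z.
Qed.

Lemma window_Gstar s z : cs (window s z) \in Gs.
Proof. by apply/mem_quotient/window_in. Qed.

Lemma coset_windowV (s : 'S_n) (z : {ffun 'I_n -> color r}) :
  ((cs (window s z))^-1 = cs (window s^-1 [ffun i => - z (s^-1 i)]))%g.
Proof.
rewrite -morphV ?window_norm //; congr coset; apply/eqP; rewrite eq_invg_mul.
apply/eqP/permP => -[i w].
by rewrite permM !windowE permK ffunE permK perm1 addKr.
Qed.

Lemma same_residue_leq x y : (x < y)%N -> x = y %[mod r] -> (x + r <= y)%N.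
Proof.
move=> xy /eqP; rewrite eq_sym eqn_mod_dvd => [rxy|]; last exact: ltnW.
by have := dvdn_leq _ rxy; lia.
Qed.

Section Statistics.
Variable h : coset_of shifts.
Hypothesis hG : h \in Gs.
Implicit Types a b : {ffun 'I_n -> nat}.

Lemma hstat_step (i j : 'I_n) : val j = i.+1 ->
  (hstat h i = (i \in HDes h) + hstat h j)%N.
Proof.
move=> ji; rewrite /hstat (cardsD1 i) !inE leqnn andbT; congr addn.
apply: eq_card => l; rewrite !inE -val_eqE -[in RHS]/(val j) ji /=.
by case: (boolP [exists _, _]) => _; lia.
Qed.

Lemma hstat_last (i : 'I_n) : i.+1 = n -> hstat h i = 0%N.
Proof.
move=> iN; apply/eqP; rewrite cards_eq0; apply/eqP/setP => l; rewrite !inE.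
apply/negbTE/negP => /andP[/existsP[j /andP[/eqP /= jl _]] il].
by move: (ltn_ord j); lia.
Qed.

Lemma hstat_antimono (i j : 'I_n) : (i <= j)%N -> (hstat h j <= hstat h i)%N.
Proof.
by move=> ij; apply/subset_leq_card/subsetP => l; rewrite !inE => /andP[-> /(leq_trans ij)].
Qed.

Lemma sigma_inj : injective (sigma h).
Proof.
by have [s [z ->]] := Gstar_window hG => i j; rewrite !sigma_coset => /perm_inj.
Qed.

Lemma has_colors_shift a b : has_colors h a ->
  (has_colors h b <-> exists t, forall i,
     tocolor r (b i) = tocolor r d *+ t + tocolor r (a i)).
Proof.
case=> s _ ->; rewrite has_colorsP; split=> -[t tE]; exists t => i;
by rewrite tE ffunE.
Qed.

Lemma same_col a (i j : 'I_n) : has_colors h a ->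
  (Defs.col h i == Defs.col h j) = (a i == a j %[mod r]).
Proof.
case=> s _ ->; have [t tE] := col_coset p s [ffun i => tocolor r (a i)].
by rewrite !tE !ffunE (inj_eq (addrI _)) tocolor_eq.
Qed.

(** Otherwise [r] could be subtracted from all the parts up to index [i], which
    changes neither the colors nor the monotonicity. *)
Lemma kmin_gap a (i j : 'I_n) : is_kmin h a -> val j = i.+1 -> (a i < a j + r)%N.
Proof.
case=> aP aC amin ji; rewrite ltnNge; apply/negP => jri.
pose c : {ffun 'I_n -> nat} := [ffun x : 'I_n => if (x <= i)%N then (a x - r)%N else a x].
have ge (x : 'I_n) : (x <= i)%N -> (r <= a x)%N.
  by move=> /aP /(leq_trans _) -> //; apply: leq_trans jri; apply: leq_addl.
have : (a i <= c i)%N.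
  apply: amin.
    move=> x y xy; rewrite !ffunE.
    have ayx := aP _ _ xy.
    case: (leqP y i) => yi; case: (leqP x i) => xi; try lia.
    have jy : (j <= y)%N by rewrite -[X in (X <= _)%N]/(val j) ji.
    by have := aP _ _ jy; have := aP _ _ xi; lia.
  apply: (has_colors_shift _ aC).2; exists 0%N => x.
  rewrite mulr0n add0r ffunE; case: (leqP x i) => // /ge rx.
  by apply/eqP; rewrite tocolor_eq -[in eqbRHS](subnK rx) modnDr.
by rewrite ffunE leqnn; have := ge i (leqnn _); lia.
Qed.

(** [b] is the sorted form of a vector from which [h] is read off: its entries
    mod [r] are colors of [h], and the letters of [h] label the entries so that
    tied entries carry increasing letters. *)
Definition compatible b : Prop :=
  has_colors h b /\
  forall i j : 'I_n, (i < j)%N ->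
    (b j < b i)%N || ((b i == b j) && (sigma h i < sigma h j)%N).

(** At a descent of [h] two consecutive entries of [b] are congruent mod [r] but
    not tied, so they differ by at least [r], and [b - r * hstat h] is still a
    partition.  It has the colors of [h], so it dominates [kvec h].  The
    difference is a partition because its parts are congruent mod [r] while the
    consecutive differences of [kvec h] are less than [r]. *)
Lemma compatible_lambda b : compatible b ->
  exists m, forall i, b i = (lambda h i + stair r d n m i)%N.
Proof.
case=> bC bP; have kmin := kvec_spec r_gt0 n_gt0 pr hG.
have [kP kC kM] := kmin; set k := kvec h in kmin kP kC kM.
have drop_step (i j : 'I_n) : val j = i.+1 ->
    (b j + r * hstat h i <= b i + r * hstat h j)%N.
  move=> ji; rewrite (hstat_step ji); have := bP i j; rewrite -[(i < j)%N]/(i < val j)%N.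
  rewrite ji ltnSn => /(_ isT) bij.
  have [|_] := boolP (i \in HDes h); last by lia.
  rewrite inE => /existsP[j' /and3P[j'E col_eq sig]].
  have ej : j' = j by apply: val_inj; rewrite (eqP j'E) ji.
  rewrite ej in col_eq sig.
  move: col_eq; rewrite (same_col _ _ bC) eq_sym => /eqP col_eq.
  have lt : (b j < b i)%N by lia.
  by have := same_residue_leq lt col_eq; lia.
have drop (i j : 'I_n) : (i <= j)%N ->
    (b j + r * hstat h i <= b i + r * hstat h j)%N.
  rewrite leq_eqVlt => /orP[/eqP/val_inj -> //|].
  apply: (ord_chain (R := fun i j => _ <= _)%N) i j => // x y z; lia.
have hb i : (r * hstat h i <= b i)%N.
  have ln : (n.-1 < n)%N by rewrite prednK.
  have il : (i <= Ordinal ln)%N by rewrite /=; move: (ltn_ord i); lia.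
  have := drop _ _ il; rewrite (@hstat_last (Ordinal ln)) /= ?prednK //; lia.
pose b' : {ffun 'I_n -> nat} := [ffun i => (b i - r * hstat h i)%N].
have b'P : is_partition b'.
  by move=> i j ij; rewrite !ffunE; have := drop _ _ ij; have := hb i; have := hb j; lia.
have b'C : has_colors h b'.
  apply: (has_colors_shift _ bC).2; exists 0%N => i; rewrite mulr0n add0r ffunE.
  by apply/eqP; rewrite tocolor_eq -[in eqbRHS](subnK (hb i)) addnC mulnC modnMDl.
have kb' := kM _ b'P b'C.
have [t tE] := (has_colors_shift _ kC).1 b'C.
pose mu : {ffun 'I_n -> nat} := [ffun i => (b' i - k i)%N].
have muC i : tocolor r (mu i) = tocolor r d *+ t.
  by rewrite ffunE tocolorB // tE addrK.
have mu_mod i j : mu i = mu j %[mod r].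
  by apply/eqP; rewrite -tocolor_eq !muC.
(* An increase of mu would be by at least r, but b' does not increase and k
   drops by less than r. *)
have mu_step (i j : 'I_n) : val j = i.+1 -> (mu j <= mu i)%N.
  move=> ji; rewrite leqNgt; apply/negP => mulr.
  have := same_residue_leq mulr (mu_mod _ _).
  have := kmin_gap kmin ji; have := kb' i; have := kb' j.
  have : (i <= j)%N by rewrite -[X in (_ <= X)%N]/(val j) ji.
  by move=> /b'P; rewrite 2![mu _]ffunE; lia.
have muT : tower r d n mu.
  apply/towerP => i j /andP[ij _]; split=> //.
    move: ij; rewrite leq_eqVlt => /orP[/eqP/val_inj -> //|].
    by apply: (ord_chain (R := fun i j => _ <= _)%N) i j => // x y z /[swap]; apply: leq_trans.
  by apply: (tocolor_dvd (t := t) (t' := 0)); rewrite mulr0n subr0.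
have [m mE] : exists m, mu = stair r d n m by apply: tower_stair.
exists m => i; rewrite -mE /lambda -/k 2!ffunE.
by have := kb' i; rewrite ffunE; have := hb i; lia.
Qed.

(** If two consecutive entries of [b] are tied, so are those of each of the three
    summands [r * hstat h], [kvec h] and the staircase; then the colors are equal
    and there is no descent, so the letters increase. *)
Lemma lambda_compatible b m :
  (forall i, b i = (lambda h i + stair r d n m i)%N) -> compatible b.
Proof.
move=> bE; have [kP kC _] := kvec_spec r_gt0 n_gt0 pr hG.
have /towerP muT := stair_tower n m d_dvd_r.
split=> [|{}].
  apply: (has_colors_shift _ kC).2.
  have [|_ _ /dvdnP[u uE]] := muT (Ordinal n_gt0) (Ordinal n_gt0); first exact: n_gt0.
  exists u => i; rewrite bE tocolorD /lambda tocolorD addrC.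
  have /eqP -> : tocolor r (r * hstat h i) == 0 by rewrite tocolor_eq0 // dvdn_mulr.
  rewrite add0r; congr (_ + _); rewrite -tocolorM mulnC -uE.
  apply/eqP; rewrite tocolor_eq eq_sym; apply/eqP.
  by have [|] := muT (Ordinal n_gt0) i; first exact: ltn_ord.
(* It suffices to compare neighbours, as the lexicographic order is transitive. *)
apply: ord_chain => [y x z|i j ji]; first by lia.
have ij : (i <= j)%N by rewrite -[X in (_ <= X)%N]/(val j) ji.
have hij := hstat_antimono ij; have kij := kP _ _ ij.
have [|muij _ _] := muT i j; first by rewrite ij ltn_ord.
rewrite !bE /lambda; have [|] := boolP (i \in HDes h) => iD.
  by have := hstat_step ji; rewrite iD; nia.
have [kE|kN] := eqVneq (kvec h i) (kvec h j); last by nia.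
have sig : (sigma h i < sigma h j)%N.
  rewrite ltn_neqAle (inj_eq val_inj) (inj_eq sigma_inj) -val_eqE ji.
  rewrite ltn_eqF //= leqNgt; apply: contra iD => sig.
  by rewrite inE; apply/existsP; exists j; rewrite ji eqxx (same_col _ _ kC) kE eqxx.
by rewrite sig; nia.
Qed.

End Statistics.

(** * Standardization of vectors *)

(** The inverse of the colored permutation obtained by sorting [a]; as an inverse,
    it carries the opposite colors. *)
Definition standardize (a : {ffun 'I_n -> nat}) : coset_of shifts :=
  cs (window (rank a) [ffun i => - tocolor r (a i)]).

(** The vector whose sorted form is [lambda (g^-1)] plus the partition given by
    [m]: [sigma g i] is the position of the letter [i] in [g^-1], hence the rank
    of the entry of index [i]. *)
Definition spread (g : coset_of shifts) (m : {ffun 'I_n -> nat}) :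
    {ffun 'I_n -> nat} :=
  [ffun i => lambda g^-1%g (sigma g i) + stair r d n m (sigma g i)]%N.

Lemma standardize_Gstar a : standardize a \in Gs.
Proof. exact: window_Gstar. Qed.

Lemma standardize_spread g m : g \in Gs -> standardize (spread g m) = g.
Proof.
move=> gG; have [s [z gE]] := Gstar_window gG.
have hE : g^-1%g = cs (window s^-1 [ffun i => - z (s^-1 i)])%g.
  by rewrite gE coset_windowV.
pose b : {ffun 'I_n -> nat} := [ffun i => spread g m (s^-1 i)%g].
have sE i : sigma g i = s i by rewrite gE sigma_coset.
have [bC bP] : compatible g^-1%g b.
  apply: lambda_compatible => [|i]; first by rewrite groupV.
  by rewrite !ffunE sE permKV.
have rE : rank (spread g m) = s.
  apply: rank_unique => i j /bP.
  by rewrite hE !sigma_coset /before [b i]ffunE [b j]ffunE.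
move: bC; rewrite hE => /has_colorsP[t tE].
rewrite /standardize rE [RHS]gE -[LHS](coset_window _ _ _ t).
congr (cs (window _ _)); apply/ffunP => i.
have := tE (s i); rewrite [b _]ffunE [X in _ + X]ffunE !permK => e; rewrite 2!ffunE e.
by rewrite opprD opprK addNKr.
Qed.

Lemma spread_standardize a : exists m, a = spread (standardize a) m.
Proof.
set g := standardize a; set s := rank a.
have hE : g^-1%g = cs (window s^-1 [ffun i => tocolor r (a (s^-1 i))])%g.
  rewrite coset_windowV; congr (cs (window _ _)).
  by apply/ffunP => i; rewrite !ffunE opprK.
have sE i : sigma g i = s i by rewrite sigma_coset.
pose b : {ffun 'I_n -> nat} := [ffun i => a (s^-1 i)%g].
have [||m mE] := @compatible_lambda g^-1%g _ b.
- by rewrite groupV standardize_Gstar.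
- split=> [|i j ij].
    rewrite hE; apply/has_colorsP; exists 0%N => i.
    by rewrite !ffunE mulr0n add0r.
  have : before a (s^-1 i)%g (s^-1 j)%g by rewrite -rank_ltE !permKV.
  by rewrite hE !sigma_coset [b i]ffunE [b j]ffunE.
by exists m; apply/ffunP => i; rewrite ffunE -mE sE ffunE permK.
Qed.

(** For [g] in C_k the ranks of the entries of index less than [k] increase, so
    these entries decrease; and their colors vanish up to a common shift, which
    is a multiple of [d]. *)
Lemma standardize_Cset k a :
  (standardize a \in Cset r p n k) = tower r d k a.
Proof.
rewrite inE standardize_Gstar /=; apply/existsP/idP => [[s /existsP[z]]|/towerP aT].
  case/and3P=> /eqP gE /forallP z0 /forallP sk.
  have sE : rank a = s.
    apply/permP => i.
    by have := congr1 (fun g => sigma g i) gE; rewrite !sigma_coset.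
  have : has_colors (standardize a) [ffun i => (- tocolor r (a i)) : nat].
    apply/has_colorsP; exists 0%N => i.
    by rewrite !ffunE mulr0n add0r tocolorK.
  rewrite gE => /has_colorsP[t tE].
  have aC (i : 'I_n) : (i < k)%N -> tocolor r (a i) = - (tocolor r d *+ t).
    move=> ik; have := tE i; rewrite !ffunE tocolorK.
    by have /implyP/(_ ik)/eqP -> := z0 i; rewrite addr0 => <-; rewrite opprK.
  apply/towerP => i j /andP[ij jk]; split.
  - move: ij; rewrite leq_eqVlt => /orP[/eqP/val_inj -> //|ij].
    have /forallP/(_ j)/implyP := sk i; rewrite ij jk -sE rank_ltE => /(_ isT).
    by rewrite /before; lia.
  - by apply/eqP; rewrite -tocolor_eq !aC // (leq_ltn_trans ij).
  - by apply: (tocolor_dvd (t := 0) (t' := t)); rewrite mulr0n sub0r aC.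
(* All the first k colors are the same multiple of d, so one shift kills them. *)
have [t tE] : exists t, forall i : 'I_n, (i < k)%N ->
    tocolor r d *+ t - tocolor r (a i) = 0.
  have [k0|k0] := posnP k; first by exists 0%N => i; rewrite k0.
  pose i0 := Ordinal n_gt0.
  have [|_ _ /dvdnP[u uE]] := aT i0 i0; first exact: k0.
  exists u => i ik; have [|_ modi _] := aT i0 i; first exact: ik.
  apply/eqP; rewrite subr_eq0 -tocolorM mulnC -uE tocolor_eq; exact/eqP.
exists (rank a); apply/existsP.
exists [ffun i => tocolor r d *+ t + [ffun i => - tocolor r (a i)] i].
rewrite coset_window eqxx /=; apply/andP; split.
  by apply/forallP => i; apply/implyP => /tE e; rewrite !ffunE e.
apply/forallP => i; apply/forallP => j; apply/implyP => /andP[ij jk].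
have [|aji _ _] := aT i j; first by rewrite ltnW.
by rewrite rank_ltE /before ij; lia.
Qed.

Lemma sum_spread g m : g \in Gs ->
  (\sum_i spread g m i = fmaj g^-1%g + \sum_(j < n) stair_weight r d n j * m j)%N.
Proof.
move=> gG; rewrite -sum_stair -big_split /= [RHS](reindex_inj (sigma_inj gG)).
by apply: eq_bigr => i _; rewrite ffunE.
Qed.

Lemma spread_inj g g' m m' : g \in Gs -> g' \in Gs ->
  spread g m = spread g' m' -> g = g' /\ m = m'.
Proof.
move=> gG gG' e.
have gg' : g = g' by rewrite -(standardize_spread m gG) e standardize_spread.
split=> //; apply: (stair_inj r_gt0 d_gt0 (leqnn n)); apply/ffunP => j.
have /codomP[i ->] : j \in codom (sigma g).
  by rewrite (injF_onto (sigma_inj gG)).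
have := congr1 (fun f : {ffun 'I_n -> nat} => f i) e.
by rewrite -gg' /= [spread g m i]ffunE [spread g m' i]ffunE => /addnI.
Qed.

(** * Comparison of the two generating functions *)

(** Both sides, divided by the two products, enumerate the vectors satisfying
    [tower r d k]: through [spread] on the pairs of an element of C_k and a vector
    in N^n, and through [stair] on the vectors in N^n alone. *)
Lemma prod_fmaj k : (k <= n)%N ->
  (\sum_(g in Cset r p n k) 'X^(fmaj g^-1%g)) *
    \prod_(j < n) (1 - 'X^(stair_weight r d k j))
  = \prod_(j < n) (1 - 'X^(stair_weight r d n j)) :> {poly int}.
Proof.
move=> kn; apply: eq_upto_all => N.
have Cs g : g \in Cset r p n k -> g \in Gs by rewrite inE => /andP[].
pose GF := \sum_(a : {ffun 'I_n -> 'I_N.+1} | tower r d k (nvec a))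
  'X^(\sum_i a i) : {poly int}.
have gfC : eq_upto N.+1 (\sum_(g in Cset r p n k) 'X^(fmaj g^-1%g))
    ((\prod_(j < n) (1 - 'X^(stair_weight r d n j))) * GF).
  apply: (gf_image (phi := spread)).
  - by move=> j; apply: (stair_weight_gt0 _ r_gt0 d_gt0).
  - by move=> g m /Cs; apply: sum_spread.
  - by move=> g g' m m' /Cs gG /Cs; apply: spread_inj gG.
  move=> a; split=> [aT|[g gC [m ->]]].
    by exists (standardize a); [rewrite standardize_Cset | apply: spread_standardize].
  by rewrite -standardize_Cset standardize_spread ?Cs.
have gfT : eq_upto N.+1 (\sum_(g in [set: unit]) 'X^0)
    ((\prod_(j < n) (1 - 'X^(stair_weight r d k j))) * GF).
  apply: (gf_image (phi := fun=> @stair r d n k)).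
  - by move=> j; apply: (stair_weight_gt0 _ r_gt0 d_gt0).
  - by move=> _ m _; rewrite sum_stair.
  - by move=> [] [] m m' _ _ /(stair_inj r_gt0 d_gt0 kn).
  move=> a; split=> [/(tower_stair kn)|[_ _ [m ->]]]; first by exists tt.
  exact: stair_tower d_dvd_r.
rewrite (big_pred1 tt) in gfT; last by case; rewrite inE.
set W := \prod_j _ in gfC *; set V := \prod_j _ in gfT *.
move=> i /ltnW iN; rewrite (eq_uptoM gfC (fun _ _ => erefl)) //.
rewrite -mulrA [GF * V]mulrC -[in RHS](mulr1 W).
by apply: (@eq_uptoM N.+1) => // j jN; rewrite -gfT.
Qed.

End Colors.

Theorem theorem5p5 (r p n k : nat) (hr : (0 < r)%N) (hp : (0 < p)%N)
    (hn : (0 < n)%N) (hpr : (p %| r)%N) (hkn : (k < n)%N)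
    (hk : (0 < k)%N \/ p = 1%N) :
  (\sum_(g in Cset r p n k) 'X ^+ fmaj (g^-1)%g
   = qint p ('X ^+ (k * r %/ p))
     * (\prod_(k.+1 <= j < n) qint (r * j) 'X)
     * qint (r * n %/ p) 'X :> {poly int})%R.
Proof.
have d0 := d_gt0 hr hpr.
have kdE m : (m * r %/ p = m * (r %/ p))%N by rewrite muln_divA.
pose Q := \prod_(j < n) (1 - 'X^(stair_weight r (r %/ p) k j)) : {poly int}.
have Q0 : Q != 0.
  apply/prodf_neq0 => j _; apply/eqP => /(congr1 (fun P : {poly int} => P`_0)).
  rewrite coefB coef1 coefXn coef0.
  by rewrite (ltn_eqF (stair_weight_gt0 k hr d0 j)).
apply: (mulIf Q0); rewrite prod_fmaj // ?(ltnW hkn) //.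
have full : \prod_(j < n) (1 - 'X^(stair_weight r (r %/ p) n j)) =
    (\prod_(1 <= j < n) (1 - 'X^(r * j))) * (1 - 'X^(r * n %/ p)) :> {poly int}.
  rewrite -(prednK hn) big_ord_recr big_add1 /= big_mkord; congr (_ * _).
    apply: eq_bigr => j _; rewrite /stair_weight /gap.
    by rewrite !ltnS ltn_ord (ltnW (ltn_ord j)) mulnC.
  by rewrite /stair_weight /gap ltnSn ltnn eqxx [in RHS]mulnC kdE.
have tail : \prod_(k.+1 <= j < n) (1 - 'X^(r * j)) =
    (\prod_(k.+1 <= j < n) qint (r * j) 'X) * (1 - 'X) ^+ (n - k.+1) :> {poly int}.
  rewrite -prodr_const_nat -big_split; apply: eq_bigr => j _; exact/esym/qintM.
have nk : (n - k = (n - k.+1).+1)%N by lia.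
rewrite full -[1 - 'X^(r * n %/ p)]qintM.
(* For k = 0 there is no full column in the generators, so that p = 1 is needed. *)
case: (posnP k) hk => [k0 [|p1]|k_gt0 _]; first by rewrite k0.
  have -> : Q = (1 - 'X) ^+ (n - k).
    rewrite /Q k0 subn0 -[n in RHS]card_ord -prodr_const; apply: eq_bigr => j _.
    by rewrite /stair_weight /gap.
  rewrite k0 in tail nk *; rewrite nk exprS tail p1.
  by rewrite /qint big_ord1 expr0; ring.
have -> : Q = (\prod_(1 <= j < k) (1 - 'X^(r * j))) * (1 - 'X^(k * r %/ p)) *
    (1 - 'X) ^+ (n - k).
  rewrite /Q -(big_mkord xpredT (fun j => 1 - 'X^(stair_weight r (r %/ p) k j))).
  rewrite (big_cat_nat _ (n := k)) ?(ltnW hkn) //= -(prodr_const_nat k n).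
  congr (_ * _); last first.
    apply: eq_big_nat => j /andP[kj _].
    by rewrite /stair_weight /gap !ltnNge (leqW kj) kj /= gtn_eqF.
  rewrite -(prednK k_gt0) big_nat_recr //= big_add1 /=; congr (_ * _).
    apply: eq_big_nat => j /andP[_ jk].
    by rewrite /stair_weight /gap !ltnS jk (ltnW jk) mulnC.
  by rewrite /stair_weight /gap ltnn ltnSn eqxx kdE.
rewrite (big_cat_nat _ (n := k)) ?(ltnW hkn) //= (big_ltn hkn) tail nk exprS.
have -> : 'X^(r * k) = ('X^(k * r %/ p)) ^+ p :> {poly int}.
  by rewrite -exprM kdE -mulnA divnK // mulnC.
by rewrite -qintM; ring.
Qed.
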